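(* Let $n\ge1$, $a_1,b_1,a_2,b_2\in\mathbb{C}$ and $C_1(\partial),C_2(\partial)\in\mathbb{C}[\partial]^{n\times n}$. Then $V_{a_1,b_1,C_1(\partial)}\cong V_{a_2,b_2,C_2(\partial)}$ as generalized conformal modules over $Vir$ if and only if $(a_1,b_1)=(a_2,b_2)$ and there exists $G(\partial)\in\mathbb{C}[\partial]^{n\times n}$ such that $\det G(\partial)\in\mathbb{C}\setminus\{0\}$ and $$G'(\partial)=G(\partial)C_1(\partial)-C_2(\partial)G(\partial).$$
   Context: The Virasoro conformal algebra is $Vir=\mathbb{C}[\partial]L$ with $[L_\lambda L]=(\partial+2\lambda)L$. A generalized conformal module $V$ over $Vir$ is a $\mathbb{C}[\partial]$-module with a linear map $L_\lambda:V\to V[[\lambda]]$ such that $L_\lambda(\partial v)=(\partial+\lambda)L_\lambda v$ and $L_\lambda(L_\mu v)-L_\mu(L_\lambda v)=(\lambda-\mu)L_{\lambda+\mu}v$ for all $v\in V$. An isomorphism is a bijective $\mathbb{C}[\partial]$-linear map $\phi$ with $\phi(L_\lambda v)=L_\lambda\phi(v)$ ($\phi$ applied coefficientwise in $\lambda$). For $a,b\in\mathbb{C}$ and $C(\partial)\in\mathbb{C}[\partial]^{n\times n}$, $V_{a,b,C(\partial)}$ is the free $\mathbb{C}[\partial]$-module $\mathbb{C}[\partial]^n$ with the action $$L_\lambda\mathbf{f}(\partial)=(\partial+a\lambda+b)e^{\lambda\mathcal{L}}\mathbf{f}(\partial)=\sum_{k\ge0}\frac{\lambda^k}{k!}\big((\partial+b)\mathcal{L}^k+ka\mathcal{L}^{k-1}\big)\mathbf{f}(\partial),$$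 where $\mathcal{L}=\frac{d}{d\partial}+C(\partial)$ acts on column vectors by $\mathcal{L}\mathbf{f}=\mathbf{f}'+C(\partial)\mathbf{f}$. This is a generalized conformal module over $Vir$. $G'(\partial)$ denotes the entrywise derivative. *)

(* Defs.v *)
From mathcomp Require Import all_boot all_order all_algebra.
From mathcomp Require Import ring.

Set Implicit Arguments.
Unset Strict Implicit.
Unset Printing Implicit Defensive.

Import GRing.Theory Num.Theory.

Local Open Scope ring_scope.

(* K plays the role of the complex field. A K[∂]-module is an lmodType over
   {poly K}, with ∂ acting as 'X and a scalar c as c%:P. An element of V[[λ]] is
   its coefficient sequence nat -> V, and an element of V[[λ, μ]] a function
   nat -> nat -> V whose value at i, j is the coefficient of λ^i μ^j. *)
Section FormalPowerSeries.
Variable V : zmodType.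

Definition fps_mulvar (f : nat -> V) : nat -> V :=
  fun k => if k is k'.+1 then f k' else 0.

Definition fps2_mullambda (F : nat -> nat -> V) : nat -> nat -> V :=
  fun i j => if i is i'.+1 then F i' j else 0.

Definition fps2_mulmu (F : nat -> nat -> V) : nat -> nat -> V :=
  fun i j => if j is j'.+1 then F i j' else 0.

(* The substitution f(λ) |-> f(λ + μ). *)
Definition fps2_of_sum (f : nat -> V) : nat -> nat -> V :=
  fun i j => f (i + j)%N *+ 'C(i + j, i).

End FormalPowerSeries.

(* gcm_act v k is the coefficient of λ^k in L_λ v, and in gcm_jacobi L_λ is
   applied to L_μ v coefficientwise in μ. *)
Record genConfModule (K : fieldType) := GenConfModule {
  gcm_sort :> lmodType {poly K};
  gcm_act : gcm_sort -> nat -> gcm_sort;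
  gcm_linear : forall (c : K) (u v : gcm_sort) k,
    gcm_act (c%:P *: u + v) k = c%:P *: gcm_act u k + gcm_act v k;
  gcm_sesquilinear : forall (v : gcm_sort) k,
    gcm_act ('X *: v) k = 'X *: gcm_act v k + fps_mulvar (gcm_act v) k;
  gcm_jacobi : forall (v : gcm_sort) i j,
    gcm_act (gcm_act v j) i - gcm_act (gcm_act v i) j =
    fps2_mullambda (fps2_of_sum (gcm_act v)) i j -
    fps2_mulmu (fps2_of_sum (gcm_act v)) i j
}.

Definition gcm_isomorphic (K : fieldType) (V W : genConfModule K) : Prop :=
  exists phi : {linear V -> W},
    bijective phi /\ forall v k, phi (gcm_act v k) = gcm_act (phi v) k.

Definition mxderiv (R : nzRingType) m n (A : 'M[{poly R}]_(m, n)) :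
  'M[{poly R}]_(m, n) := map_mx (@deriv R) A.

Section Vabc.
Variables (K : numFieldType) (n : nat) (a b : K) (C : 'M[{poly K}]_n).
Implicit Types (f : 'cV[{poly K}]_n).

Definition calL f : 'cV[{poly K}]_n := mxderiv f + C *m f.

(* The coefficient of λ^k in (∂ + aλ + b) e^{λ𝓛} f. For k = 0 the exponent k.-1
   is a dummy: that term has coefficient 0. *)
Definition Vabc_act f (k : nat) : 'cV[{poly K}]_n :=
  ((k`!)%:R^-1)%:P *:
    (('X + b%:P) *: iter k calL f + (k%:R * a)%:P *: iter k.-1 calL f).

Lemma calL_linear c f g : calL (c%:P *: f + g) = c%:P *: calL f + calL g.
Proof.
rewrite /calL mulmxDr -scalemxAr scalerDr addrACA; congr (_ + _).
by apply/matrixP => i j; rewrite !mxE derivD derivM derivC mul0r add0r.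
Qed.

Lemma calLX f : calL ('X *: f) = 'X *: calL f + f.
Proof.
rewrite /calL -scalemxAr scalerDr addrAC; congr (_ + _).
by apply/matrixP => i j; rewrite !mxE derivM derivX mul1r addrC.
Qed.

Lemma iter_calL_linear k c f g :
  iter k calL (c%:P *: f + g) = c%:P *: iter k calL f + iter k calL g.
Proof. by elim: k => //= k ->; rewrite calL_linear. Qed.

Lemma iter_calLD k f g : iter k calL (f + g) = iter k calL f + iter k calL g.
Proof. by have := iter_calL_linear k 1 f g; rewrite polyC1 !scale1r. Qed.

Lemma iter_calLZ k c f : iter k calL (c%:P *: f) = c%:P *: iter k calL f.
Proof.
have H0 : iter k calL 0 = 0.
  by apply: (@addrI _ (iter k calL 0)); rewrite -iter_calLD !addr0.
by have := iter_calL_linear k c f 0; rewrite H0 !addr0.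
Qed.

Lemma iter_calLX k f :
  iter k calL ('X *: f) = 'X *: iter k calL f + (k%:R)%:P *: iter k.-1 calL f.
Proof.
elim: k => [|k IH]; first by rewrite polyC0 scale0r addr0.
rewrite iterS IH addrC calL_linear calLX [RHS]/= -[in RHS]natr1.
rewrite addrC -addrA; congr (_ + _).
rewrite polyCD scalerDl polyC1 scale1r addrC; congr (_ + _).
by case: k {IH} => [|k] //; rewrite polyC0 !scale0r.
Qed.

Lemma Vabc_linear (c : K) f g k :
  Vabc_act (c%:P *: f + g) k = c%:P *: Vabc_act f k + Vabc_act g k.
Proof.
rewrite /Vabc_act !iter_calL_linear.
by apply/matrixP => i j; rewrite !mxE; ring.
Qed.

Lemma invfactS k : k`!%:R^-1 = k.+1%:R * (k.+1)`!%:R^-1 :> K.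
Proof. by rewrite factS natrM invfM mulrA mulfV ?mul1r ?pnatr_eq0. Qed.

Lemma Vabc_sesquilinear f k :
  Vabc_act ('X *: f) k = 'X *: Vabc_act f k + fps_mulvar (Vabc_act f) k.
Proof.
case: k => [|k]; rewrite /Vabc_act !iter_calLX /=.
  by apply/matrixP => i j; rewrite !mxE !mul0r ?polyC0; ring.
rewrite (invfactS k).
apply/matrixP => i j; rewrite !mxE !polyCM; ring.
Qed.

Definition Vabc_num f k : 'cV[{poly K}]_n :=
  ('X + b%:P) *: iter k calL f + (k%:R * a)%:P *: iter k.-1 calL f.

Lemma iter_calLXb k f : iter k calL (('X + b%:P) *: f) =
  ('X + b%:P) *: iter k calL f + (k%:R)%:P *: iter k.-1 calL f.
Proof. by rewrite !scalerDl iter_calLD iter_calLX iter_calLZ addrAC. Qed.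

Lemma Vabc_num_comm f i j :
  Vabc_num (Vabc_num f j) i - Vabc_num (Vabc_num f i) j =
  (i%:R - j%:R)%:P *: Vabc_num f (i + j).-1.
Proof.
rewrite /Vabc_num !iter_calLD !iter_calLXb !iter_calLZ -!iterD.
case: i => [|[|i]]; case: j => [|[|j]];
  rewrite ?addSn ?addnS ?add0n ?addn0 [_.-1]/= ?addSn ?addnS ?addn0 ?(addnC j i);
  by apply/matrixP => u v; rewrite !mxE /= -?natr1 ?natrD -?natr1; ring.
Qed.

Lemma fps2_of_sumE f i j : fps2_of_sum (Vabc_act f) i j =
  (i`!%:R^-1 * j`!%:R^-1)%:P *: Vabc_num f (i + j).
Proof.
rewrite /fps2_of_sum /Vabc_act -/(Vabc_num _ _) -scaler_nat scalerA.
rewrite -polyC_natr -polyCM; congr (_%:P *: _).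
have := bin_fact (leq_addr j i); rewrite addKn => <-.
rewrite !natrM !invfM mulVKf //.
by rewrite pnatr_eq0 -lt0n bin_gt0 leq_addr.
Qed.

Lemma Vabc_jacobi f i j :
  Vabc_act (Vabc_act f j) i - Vabc_act (Vabc_act f i) j =
  fps2_mullambda (fps2_of_sum (Vabc_act f)) i j -
  fps2_mulmu (fps2_of_sum (Vabc_act f)) i j.
Proof.
have actE g k : Vabc_act g k = (k`!%:R^-1)%:P *: Vabc_num g k by [].
rewrite [Vabc_act (Vabc_act f j) i]actE [Vabc_act (Vabc_act f i) j]actE.
have numE g k l : Vabc_num (Vabc_act g k) l =
    (k`!%:R^-1)%:P *: Vabc_num (Vabc_num g k) l.
  rewrite /Vabc_num /Vabc_act !iter_calLZ.
  by apply/matrixP => u v; rewrite !mxE; ring.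
rewrite !numE !scalerA -!polyCM [j`!%:R^-1 * _]mulrC -scalerBr Vabc_num_comm.
case: i => [|i]; case: j => [|j];
  rewrite /fps2_mullambda /fps2_mulmu ?fps2_of_sumE.
- by rewrite !subrr polyC0 scale0r scaler0.
- rewrite add0n (invfactS j) scalerA -polyCM !sub0r -scaleNr -polyCN.
  by congr (_%:P *: _); ring.
- rewrite addSn addn0 (invfactS i) scalerA -polyCM !subr0.
  by congr (_%:P *: _); ring.
- rewrite addSn addnS [_.-1]/= (invfactS i) (invfactS j).
  rewrite -scalerBl -polyCB scalerA -polyCM.
  by congr (_%:P *: _); ring.
Qed.

Definition Vabc : genConfModule K :=
  GenConfModule Vabc_linear Vabc_sesquilinear Vabc_jacobi.

End Vabc.

(* Main.v *)
Require Import Defs.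
From mathcomp Require Import all_boot all_order all_algebra.
From mathcomp Require Import reals complex.
From mathcomp Require Import ring.

Set Implicit Arguments.
Unset Strict Implicit.
Unset Printing Implicit Defensive.

Import GRing.Theory Num.Theory.
Local Open Scope ring_scope.

(** A [K[∂]]-linear bijection of [K[∂]^n] is multiplication by a matrix [G] that is
invertible over [K[∂]]. Put [D = G C1 - C2 G - G'], so that [G 𝓛1 - 𝓛2 G] is
multiplication by [D]. Compatibility with the coefficient of [λ^0] gives
[b1 = b2 = b], and with that of [λ^1] gives [(∂ + b) D = (a2 - a1) G]. Multiplying
by [G^-1] and evaluating at [∂ = -b] yields [a1 = a2], hence [D = 0]. Conversely,
if [D = 0] then [G] intertwines all powers of [𝓛1] and [𝓛2]. *)

Lemma linear_colE (S : comNzRingType) m n (phi : {linear 'cV[S]_n -> 'cV[S]_m}) f :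
  phi f = (\matrix_(i, j) phi (delta_mx j 0) i 0) *m f.
Proof.
rewrite [in LHS](matrix_sum_delta f) linear_sum /=.
apply/matrixP => i k; rewrite ord1 summxE mxE.
by apply: eq_bigr => j _; rewrite big_ord1 linearZ !mxE mulrC.
Qed.

Lemma mulmx_delta_inj (S : pzSemiRingType) m n (A B : 'M[S]_(m, n)) :
  (forall j, A *m (delta_mx j 0 : 'cV_n) = B *m delta_mx j 0) -> A = B.
Proof.
move=> AB; apply/matrixP => i j; have := AB j; rewrite -!colE.
by move/matrixP/(_ i 0); rewrite !mxE.
Qed.

Lemma mxderivM (S : comNzRingType) m n p
    (A : 'M[{poly S}]_(m, n)) (B : 'M[{poly S}]_(n, p)) :
  mxderiv (A *m B) = mxderiv A *m B + A *m mxderiv B.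
Proof.
apply/matrixP => i k; rewrite !mxE raddf_sum -big_split /=.
by apply: eq_bigr => j _; rewrite derivM !mxE.
Qed.

Section Isomorphisms.
Variables (K : numFieldType) (n : nat).
Implicit Types (a b : K) (C G : 'M[{poly K}]_n) (f : 'cV[{poly K}]_n).

(** By the Leibniz rule the terms in [f'] cancel between the two sides, so the failure of [G] to
    intertwine the two operators is a matrix multiplication. *)
Lemma calL_mulmx C1 C2 G f :
  calL C2 (G *m f) =
  G *m calL C1 f - (G *m C1 - C2 *m G - mxderiv G) *m f.
Proof.
rewrite /calL mxderivM mulmxDr !mulmxBl !mulmxA.
by apply/matrixP => i j; rewrite !mxE; ring.
Qed.

Lemma Vabc_act0 a b C f : Vabc_act a b C f 0 = ('X + b%:P) *: f.
Proof. by rewrite /Vabc_act invr1 polyC1 scale1r mul0r polyC0 scale0r addr0. Qed.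

Lemma Vabc_act1 a b C f :
  Vabc_act a b C f 1 = ('X + b%:P) *: calL C f + a%:P *: f.
Proof. by rewrite /Vabc_act invr1 polyC1 scale1r mul1r. Qed.

Lemma polyXD_neq0 b : 'X + b%:P != 0 :> {poly K}.
Proof. by rewrite -size_poly_eq0 size_XaddC. Qed.

Lemma scalemx_lreg m p (c : {poly K}) (A B : 'M[{poly K}]_(m, p)) :
  c != 0 -> c *: A = c *: B -> A = B.
Proof.
move=> c0 cAB; apply/matrixP => i j; apply: (mulfI c0).
by move/matrixP/(_ i j): cAB; rewrite !mxE.
Qed.

(** The index [i0] witnesses that [n] is positive: scalars are recovered from the [(i0, i0)] entry
    of a scalar matrix. *)
Lemma intertwiner_params (i0 : 'I_n) a1 b1 a2 b2 C1 C2 G :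
  G \in unitmx ->
  (forall f k, G *m Vabc_act a1 b1 C1 f k = Vabc_act a2 b2 C2 (G *m f) k) ->
  (a1, b1) = (a2, b2) /\ mxderiv G = G *m C1 - C2 *m G.
Proof.
move=> Gu Gact.
have b12 : b1 = b2.
  have : ('X + b1%:P) *: G = ('X + b2%:P) *: G.
    apply: mulmx_delta_inj => j; have := Gact (delta_mx j 0) 0%N.
    by rewrite !Vabc_act0 -scalemxAr -!scalemxAl.
  move/(congr1 (mulmx^~ (invmx G))); rewrite -!scalemxAl mulmxV //.
  move/matrixP/(_ i0 i0); rewrite !mxE eqxx !mulr1 => /addrI.
  exact: polyC_inj.
move: b2 b12 Gact => b <- {b} Gact; move: b1 Gact => b Gact.
pose D := G *m C1 - C2 *m G - mxderiv G.
(* In the coefficient of [λ^1], the terms [(∂ + b) G 𝓛1 f] on both sides cancel. *)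
have DE : ('X + b%:P) *: D = (a2 - a1)%:P *: G.
  apply: mulmx_delta_inj => j; have := Gact (delta_mx j 0) 1%N.
  rewrite !Vabc_act1 (calL_mulmx C1) -/D mulmxDr -!scalemxAr -!scalemxAl.
  rewrite scalerBr -addrA => /addrI; rewrite polyCB scalerBl => ->.
  by rewrite opprD opprK addrCA subrr addr0.
have a12 : a1 = a2.
  move/(congr1 (mulmx^~ (invmx G))): DE; rewrite -!scalemxAl mulmxV //.
  (* The left side is a multiple of [∂ + b] and vanishes at [-b]; the right side is the constant
     [a2 - a1]. *)
  move/matrixP/(_ i0 i0)/(congr1 (fun p => p.[- b])).
  rewrite !mxE eqxx !hornerE addNr mul0r => /esym/eqP.
  by rewrite subr_eq0 => /eqP.
split; first by rewrite a12.
apply/esym/eqP; rewrite -subr_eq0 -/D; apply/eqP.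
apply: (scalemx_lreg (polyXD_neq0 b)).
by rewrite DE a12 subrr polyC0 scale0r scaler0.
Qed.

Lemma intertwiner_act a b C1 C2 G f k :
  mxderiv G = G *m C1 - C2 *m G ->
  G *m Vabc_act a b C1 f k = Vabc_act a b C2 (G *m f) k.
Proof.
move=> dG.
(* The equation for [G'] says exactly that the defect in [calL_mulmx] is zero. *)
have LE g : G *m calL C1 g = calL C2 (G *m g).
  by rewrite (calL_mulmx C1) dG subrr mul0mx subr0.
have iterE l : G *m iter l (calL C1) f = iter l (calL C2) (G *m f).
  by elim: l => //= l <-; rewrite LE.
by rewrite /Vabc_act -scalemxAr mulmxDr -!scalemxAr !iterE.
Qed.

(** The units of [K[∂]] are the nonzero constants. *)
Lemma unitmx_polyP G :
  G \in unitmx <-> exists c : K, c != 0 /\ \det G = c%:P.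
Proof.
rewrite unitmxE poly_unitE; split=> [/andP[/size_poly1P[c c0 ->] _]|[c [c0 ->]]].
  by exists c.
by rewrite size_polyC c0 coefC unitfE.
Qed.

Lemma Vabc_isomorphicP (i0 : 'I_n) a1 b1 a2 b2 C1 C2 :
  gcm_isomorphic (Vabc a1 b1 C1) (Vabc a2 b2 C2) <->
  (a1, b1) = (a2, b2) /\
  exists G, (exists c : K, c != 0 /\ \det G = c%:P) /\
    mxderiv G = G *m C1 - C2 *m G.
Proof.
split=> [[phi [[psi _ psiK] phi_act]]|[[<- <-] [G [/unitmx_polyP Gu dG]]]].
  (* The carrier of [Vabc] is definitionally a space of columns, so [phi] and [psi] can be retyped
     to allow matrix lemmas. *)
  pose phi' : {linear 'cV[{poly K}]_n -> 'cV[{poly K}]_n} := phi.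
  pose psi' : 'cV[{poly K}]_n -> 'cV[{poly K}]_n := psi.
  pose G := \matrix_(i, j) phi' (delta_mx j 0) i 0.
  have phiE f : phi' f = G *m f by exact: linear_colE.
  have Gu : G \in unitmx.
    (* Linearity of [psi] is not at hand, but its values on the basis suffice: they give a right
       inverse of [G], and a one-sided inverse of a square matrix is two-sided. *)
    pose H := \matrix_(i, j) psi' (delta_mx j 0) i 0.
    suff /mulmx1_unit[] : G *m H = 1%:M by [].
    apply: mulmx_delta_inj => j; rewrite mul1mx -mulmxA.
    have -> : H *m delta_mx j 0 = psi' (delta_mx j 0).
      by rewrite -colE; apply/matrixP => i k; rewrite ord1 !mxE.
    by rewrite -phiE; exact: psiK.
  have [|ab dG] := @intertwiner_params i0 a1 b1 a2 b2 C1 C2 G Gu.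
    by move=> f k; rewrite -!phiE; exact: phi_act.
  by split=> //; exists G; split=> //; apply/unitmx_polyP.
pose phi : {linear Vabc a1 b1 C1 -> Vabc a1 b1 C2} :=
  (mulmx G : {linear 'cV[{poly K}]_n -> 'cV[{poly K}]_n}).
exists phi; split; last by move=> f k; exact: intertwiner_act.
exact: Bijective (mulKmx Gu) (mulKVmx Gu).
Qed.

End Isomorphisms.

Theorem proposition4p18 (R : realType) (n : nat) (hn : (1 <= n)%N)
    (a1 b1 a2 b2 : R[i]) (C1 C2 : 'M[{poly R[i]}]_n) :
  gcm_isomorphic (Vabc a1 b1 C1) (Vabc a2 b2 C2) <->
  (a1, b1) = (a2, b2) /\
  exists G : 'M[{poly R[i]}]_n,
    (exists c : R[i], c != 0 /\ \det G = c%:P) /\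
    mxderiv G = G *m C1 - C2 *m G.
Proof. exact: Vabc_isomorphicP (Ordinal hn) _ _ _ _ _ _. Qed.
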